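(* Let $R$ and $S$ be Morita equivalent semirings. Then $R$ is congruence-simple if and only if $S$ is congruence-simple; $R$ is ideal-simple if and only if $S$ is ideal-simple; and $R$ is simple if and only if $S$ is simple.
   Context: A semiring $(R,+,\cdot,0,1)$ consists of a commutative monoid $(R,+,0)$ and a monoid $(R,\cdot,1)$ such that multiplication distributes over addition on both sides and $0r=0=r0$ for all $r\in R$. A left $R$-semimodule is a commutative monoid $(M,+,0_M)$ with a scalar multiplication $R\times M\to M$ satisfying $(rr')m=r(r'm)$, $r(m+m')=rm+rm'$, $(r+r')m=rm+r'm$, $r0_M=0_M=0m$ and $1m=m$; ${}_R\mathcal{M}$ is the category of left $R$-semimodules and semimodule homomorphisms. Semirings $R$ and $S$ are Morita equivalent if ${}_R\mathcal{M}$ and ${}_S\mathcal{M}$ are equivalent categories, i.e. there are (additive) functors $F:{}_R\mathcal{M}\to{}_S\mathcal{M}$ and $G:{}_S\mathcal{M}\to{}_R\mathcal{M}$ with natural isomorphisms $GF\cong \mathrm{Id}$ and $FG\cong\mathrm{Id}$. An ideal is an additive submonoid closed under left and right multiplication by elements of the semiring. A semiring $R$ is ideal-simple if $0$ and $R$ are its only ideals; congruence-simple if the diagonal and $R^2$ are its only congruences; simple if it is both. *)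

(* Defs.v *)
From mathcomp Require Import all_boot all_order all_algebra.
From mathcomp Require Import boolp classical_sets.

Set Implicit Arguments.
Unset Strict Implicit.
Unset Printing Implicit Defensive.

Import GRing.Theory.
Local Open Scope ring_scope.
Local Open Scope classical_set_scope.

(* Semirings are [pzSemiRingType]s (not necessarily commutative, [0 = 1]
   allowed), left R-semimodules are [lSemiModType R]s, and the homomorphisms
   are [{linear M -> N}], which over a semiring means preservation of 0, of +
   and of the scalar action. *)

Definition is_ideal (R : pzSemiRingType) (I : set R) : Prop :=
  [/\ I 0,
      forall x y, I x -> I y -> I (x + y),
      forall r x, I x -> I (r * x) &
      forall r x, I x -> I (x * r)].

Definition ideal_simple (R : pzSemiRingType) : Prop :=
  forall I : set R, is_ideal I -> I = [set 0] \/ I = [set: R].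

Definition is_congruence (R : pzSemiRingType) (rho : R -> R -> Prop) : Prop :=
  [/\ forall x, rho x x,
      forall x y, rho x y -> rho y x &
      forall x y z, rho x y -> rho y z -> rho x z] /\
  (forall x x' y y', rho x x' -> rho y y' ->
     rho (x + y) (x' + y') /\ rho (x * y) (x' * y')).

Definition congruence_simple (R : pzSemiRingType) : Prop :=
  forall rho : R -> R -> Prop, is_congruence rho ->
    (forall x y, rho x y <-> x = y) \/ (forall x y, rho x y).

Definition simple_semiring (R : pzSemiRingType) : Prop :=
  congruence_simple R /\ ideal_simple R.

(* Equality of morphisms is written pointwise throughout; this agrees with
   equality in the bundled type [{linear M -> N}]. *)
Lemma linear_ext (R : pzSemiRingType) (M N : lSemiModType R)
  (f g : {linear M -> N}) : f =1 g -> f = g.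
Proof.
case: f g => [f [[[f0 fD]] [fZ]]] [g [[[g0 gD]] [gZ]]] /= /funext fg.
case: _ / fg in g0 gD gZ *.
by rewrite (Prop_irrelevance g0 f0) (Prop_irrelevance gD fD)
           (Prop_irrelevance gZ fZ).
Qed.

Record semimod_functor (R S : pzSemiRingType) := SemimodFunctor {
  fobj :> lSemiModType R -> lSemiModType S;
  fmap : forall M N : lSemiModType R,
    {linear M -> N} -> {linear fobj M -> fobj N};
  fmap_id : forall M : lSemiModType R,
    fmap (idfun : {linear M -> M}) =1 idfun;
  fmap_comp : forall (M N P : lSemiModType R)
    (g : {linear N -> P}) (f : {linear M -> N}),
    fmap (g \o f : {linear M -> P}) =1 fmap g \o fmap f }.

Arguments fmap_id {R S} F M _ : rename.
Arguments fmap_comp {R S} F {M N P} g f _ : rename.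

Definition additive_functor (R S : pzSemiRingType)
    (F : semimod_functor R S) : Prop :=
  forall M N : lSemiModType R,
    fmap F (\0 : {linear M -> N}) =1 \0 /\
    (forall f g : {linear M -> N},
       fmap F (f \+ g : {linear M -> N}) =1 fmap F f \+ fmap F g).

Definition id_functor (R : pzSemiRingType) : semimod_functor R R :=
  {| fobj := fun M => M;
     fmap := fun M N f => f;
     fmap_id := fun M => frefl _;
     fmap_comp := fun M N P g f => frefl _ |}.

Definition comp_fmap (R S T : pzSemiRingType)
    (G : semimod_functor S T) (F : semimod_functor R S)
    (M N : lSemiModType R) (f : {linear M -> N}) :
    {linear G (F M) -> G (F N)} :=
  fmap G (fmap F f).

Lemma comp_fmap_id (R S T : pzSemiRingType)
    (G : semimod_functor S T) (F : semimod_functor R S)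
    (M : lSemiModType R) :
  comp_fmap G F (idfun : {linear M -> M}) =1 idfun.
Proof.
by move=> x; rewrite /comp_fmap (linear_ext (fmap_id F M)) fmap_id.
Qed.

Lemma comp_fmap_comp (R S T : pzSemiRingType)
    (G : semimod_functor S T) (F : semimod_functor R S)
    (M N P : lSemiModType R) (g : {linear N -> P}) (f : {linear M -> N}) :
  comp_fmap G F (g \o f : {linear M -> P}) =1
  comp_fmap G F g \o comp_fmap G F f.
Proof.
by move=> x; rewrite /comp_fmap (linear_ext (fmap_comp F g f)) fmap_comp.
Qed.

Definition comp_functor (R S T : pzSemiRingType)
    (G : semimod_functor S T) (F : semimod_functor R S) :
    semimod_functor R T :=
  {| fobj := fun M => G (F M);
     fmap := comp_fmap G F;
     fmap_id := @comp_fmap_id R S T G F;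
     fmap_comp := @comp_fmap_comp R S T G F |}.

Record nat_iso (R S : pzSemiRingType) (F G : semimod_functor R S) := NatIso {
  iso_fwd : forall M : lSemiModType R, {linear F M -> G M};
  iso_bwd : forall M : lSemiModType R, {linear G M -> F M};
  iso_fwdK : forall M : lSemiModType R, cancel (iso_fwd M) (iso_bwd M);
  iso_bwdK : forall M : lSemiModType R, cancel (iso_bwd M) (iso_fwd M);
  iso_natural : forall (M N : lSemiModType R) (f : {linear M -> N}),
    iso_fwd N \o fmap F f =1 fmap G f \o iso_fwd M }.

Definition morita_equivalent (R S : pzSemiRingType) : Prop :=
  exists (F : semimod_functor R S) (G : semimod_functor S R),
    [/\ additive_functor F, additive_functor G,
        inhabited (nat_iso (comp_functor G F) (id_functor R)) &
        inhabited (nat_iso (comp_functor F G) (id_functor S))].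

(* Main.v *)
(** The trace in [S] of the S-semimodule [F R] is all of [S]: its inclusion into
    [S] is sent by [G] to a monomorphism through which every map [R -> G S]
    factors, hence to an isomorphism.  So [1 = \sum_i p_i x_i] for linear maps
    [p_i : F R -> S] and vectors [x_i : F R].  As [F] is full, the matrix
    entries [p x g y] of [g : S] are then governed by elements of [R] acting on
    [F R], which lets an ideal or a congruence of [S] be pulled back to [R]
    and be recovered from its pullback. *)
Require Import Defs.
From HB Require Import structures.
From mathcomp Require Import all_boot all_order all_algebra.
From mathcomp Require Import boolp classical_sets.

Set Implicit Arguments.
Unset Strict Implicit.
Unset Printing Implicit Defensive.

Import GRing.Theory.
Local Open Scope ring_scope.
Local Open Scope classical_set_scope.

(** Maps out of [R^o] stand for elements of [M], so that functors, which see only maps, can be used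
    on elements. *)
Definition orbit_map (R : pzSemiRingType) (M : lSemiModType R) (x : M)
  (r : R^o) : M := (r : R) *: x.

Lemma orbit_map_semilinear (R : pzSemiRingType) (M : lSemiModType R) (x : M) :
  semilinear (orbit_map x).
Proof.
by split=> [a r|r s]; rewrite /orbit_map ?scalerA // scalerDl.
Qed.

HB.instance Definition _ (R : pzSemiRingType) (M : lSemiModType R) (x : M) :=
  GRing.isSemilinear.Build R R^o M *:%R (orbit_map x) (orbit_map_semilinear x).

Lemma orbit_map1 (R : pzSemiRingType) (M : lSemiModType R) (x : M) :
  orbit_map x 1 = x.
Proof. exact: scale1r. Qed.

Lemma linear_orbit_map (R : pzSemiRingType) (M N : lSemiModType R)
  (f : {linear M -> N}) (x : M) : f \o orbit_map x =1 orbit_map (f x).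
Proof. by move=> r; rewrite /orbit_map /= linearZ. Qed.

Lemma linear_inverse (R : pzSemiRingType) (M N : lSemiModType R)
    (f : {linear M -> N}) :
  injective f -> (forall y, exists x, f x = y) ->
  exists g : {linear N -> M}, cancel g f.
Proof.
move=> f_inj /choice[g gK].
have fK : cancel f g by move=> x; apply: f_inj; rewrite gK.
by exists (HB.pack_for {linear _ -> _} g (GRing.isSemilinear.Build R N M *:%R g
                        (can2_semilinear fK gK))).
Qed.

(** Boolean-valued, so that the subtype below inherits its semimodule structure from [N]. *)
Definition trace (R : pzSemiRingType) (M N : lSemiModType R) : {pred N} :=
  fun y => `[< exists s : seq ({linear M -> N} * M),
                 y = \sum_(p <- s) p.1 p.2 >].
Arguments trace {R} M N.

Lemma trace_closed (R : pzSemiRingType) (M N : lSemiModType R) :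
  subsemimod_closed (trace M N).
Proof.
split; [split|].
- by apply/asboolP; exists [::]; rewrite big_nil.
- move=> _ _ /asboolP[s ->] /asboolP[t ->]; apply/asboolP.
  by exists (s ++ t); rewrite big_cat.
- move=> a _ /asboolP[s ->]; apply/asboolP.
  exists [seq (p.1, a *: p.2) | p <- s]; rewrite big_map scaler_sumr.
  by apply: eq_bigr => p _; rewrite linearZ.
Qed.

Lemma mem_trace (R : pzSemiRingType) (M N : lSemiModType R)
  (f : {linear M -> N}) (x : M) : f x \in trace M N.
Proof. by apply/asboolP; exists [:: (f, x)]; rewrite big_seq1. Qed.

HB.instance Definition _ (R : pzSemiRingType) (M N : lSemiModType R) :=
  GRing.isSubSemiModClosed.Build R N (trace M N) (@trace_closed R M N).

Definition trace_sub (R : pzSemiRingType) (M N : lSemiModType R) : Type :=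
  {y : N | y \in trace M N}.
Arguments trace_sub {R} M N.

HB.instance Definition _ (R : pzSemiRingType) (M N : lSemiModType R) :=
  SubChoice.on (trace_sub M N).
HB.instance Definition _ (R : pzSemiRingType) (M N : lSemiModType R) :=
  [SubChoice_isSubLSemiModule of trace_sub M N by <:].

Lemma trace_corestrict (R : pzSemiRingType) (M N : lSemiModType R)
    (f : {linear M -> N}) :
  exists g : {linear M -> trace_sub M N}, forall x, val (g x) = f x.
Proof.
pose g x : trace_sub M N := exist _ (f x) (mem_trace f x).
have g_lin : semilinear g.
  by split=> [a x|x y]; apply: val_inj; rewrite /= ?linearZ ?linearD.
by exists (HB.pack_for {linear _ -> _} g (GRing.isSemilinear.Build R M (trace_sub M N) *:%R g
                        g_lin)).
Qed.

(** By naturality of [e], [f] is the conjugate of [fmap G (fmap F f)], so [fmap F f] determines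
    it. *)
Lemma fmap_faithful (R S : pzSemiRingType)
    (F : semimod_functor R S) (G : semimod_functor S R)
    (e : nat_iso (comp_functor G F) (id_functor R))
    (M N : lSemiModType R) (f g : {linear M -> N}) :
  fmap F f =1 fmap F g -> f =1 g.
Proof.
move=> /linear_ext fg x; rewrite -[x](iso_bwdK e).
have /= <- := iso_natural e f (iso_bwd e M x).
have /= <- := iso_natural e g (iso_bwd e M x).
by rewrite /comp_fmap fg.
Qed.

(** The preimage is [fmap G h] conjugated by [e]: its image under [F] agrees with [h] after applying
    [G], which is faithful. *)
Lemma fmap_full (R S : pzSemiRingType)
    (F : semimod_functor R S) (G : semimod_functor S R)
    (e : nat_iso (comp_functor G F) (id_functor R))
    (d : nat_iso (comp_functor F G) (id_functor S))
    (M N : lSemiModType R) (h : {linear F M -> F N}) :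
  exists f : {linear M -> N}, fmap F f =1 h.
Proof.
pose f : {linear M -> N} := iso_fwd e N \o fmap G h \o iso_bwd e M.
exists f; apply: (fmap_faithful d) => x; apply: (can_inj (iso_fwdK e (M:=N))).
have /= -> := iso_natural e f x.
by rewrite (iso_fwdK e).
Qed.

Section Transfer.
Variables (R S : pzSemiRingType).
Variables (F : semimod_functor R S) (G : semimod_functor S R).
Variable (e : nat_iso (comp_functor G F) (id_functor R)).
Variable (d : nat_iso (comp_functor F G) (id_functor S)).

(** Elements of [G M] are maps from [R^o], and [F] is faithful on these; after applying [F], the
    isomorphism [d] replaces [fmap G i] by [i] itself, which can be cancelled. *)
Lemma fmap_mono (M N : lSemiModType S) (i : {linear M -> N}) :
  injective i -> injective (fmap G i).
Proof.
move=> i_inj x y ixy.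
suff xy : orbit_map x =1 orbit_map y by rewrite -(orbit_map1 x) xy orbit_map1.
apply: (fmap_faithful e) => z; apply: (can_inj (iso_fwdK d (M:=M))).
apply: i_inj.
have nat w : i (iso_fwd d M w) = iso_fwd d N (fmap F (fmap G i) w).
  by rewrite -[LHS](iso_natural d i w).
rewrite !nat; congr (iso_fwd d N _).
rewrite -[LHS](fmap_comp F) -[RHS](fmap_comp F).
congr (fmap F _ z); apply: linear_ext => r /=.
by rewrite /orbit_map !linearZ /= ixy.
Qed.

Lemma trace_generates (y : S^o) : y \in trace (F R^o) S^o.
Proof.
pose T := trace_sub (F R^o) S^o.
pose i : {linear T -> S^o} := val.
have Gi_surj z : exists t, fmap G i t = z.
  (* Read through [F] and [d], the element [z] is a map [F R^o -> S^o]; it lands in the trace, and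
     its corestriction [p] comes from a map [b] by fullness. *)
  have [p pE] :=
    trace_corestrict (iso_fwd d S^o \o fmap F (orbit_map z) : {linear _ -> _}).
  have [b bE] := fmap_full e d (iso_bwd d T \o p : {linear _ -> _}).
  exists (b 1); rewrite -[RHS]orbit_map1.
  apply: (fmap_faithful e (f := fmap G i \o b : {linear _ -> _})) => w.
  rewrite fmap_comp /= bE /=; apply: (can_inj (iso_fwdK d (M:=S^o))).
  have /= -> := iso_natural d i (iso_bwd d T (p w)).
  by rewrite (iso_bwdK d) /i /= pE.
(* The inverse [j] of [fmap G i] is some [fmap G k], and faithfulness of [G] makes [k] a section of
   the inclusion [i], which is therefore onto. *)
have [j jK] := linear_inverse (fmap_mono (@val_inj _ _ T)) Gi_surj.
have [k kE] := fmap_full d e j.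
have ik : i \o k =1 idfun.
  apply: (fmap_faithful d (f := i \o k : {linear _ -> _})) => w.
  by rewrite fmap_comp /= kE jK (fmap_id G).
by rewrite -[y]/(idfun y) -ik; apply: valP.
Qed.

Hypothesis (addF : additive_functor F).

(** On [R^o], [orbit_map r] is right multiplication by [r]; through [F] this makes [F R^o] a right
    [R]-semimodule, whence the order of factors in [ractM]. *)
Definition ract (r : R) : {linear F R^o -> F R^o} :=
  fmap F (orbit_map (r : R^o)).

Lemma ract1 x : ract 1 x = x.
Proof.
rewrite -[RHS](fmap_id F); congr (fmap F _ x); apply: linear_ext => r.
by rewrite /orbit_map /= -[LHS]/(r * 1) mulr1.
Qed.

Lemma ract0 x : ract 0 x = 0.
Proof.
rewrite -[RHS]((addF R^o R^o).1 x); congr (fmap F _ x); apply: linear_ext => r.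
exact: scaler0.
Qed.

Lemma ractD r s x : ract (r + s) x = ract r x + ract s x.
Proof.
rewrite -[RHS]((addF R^o R^o).2 (orbit_map _) (orbit_map _) x).
congr (fmap F _ x); apply: linear_ext => t; exact: scalerDr.
Qed.

Lemma ractM r s x : ract (r * s) x = ract s (ract r x).
Proof.
rewrite -[RHS](fmap_comp F (orbit_map (s : R^o)) (orbit_map (r : R^o))).
congr (fmap F _ x); apply: linear_ext => t.
exact: mulrA.
Qed.

(** The right-hand side is an [S]-endomorphism of [F R^o], hence the image of an endomorphism [f] of
    [R^o], and such an [f] is right multiplication by [f 1]. *)
Lemma matrix_entry (g : S) (p : {linear F R^o -> S^o}) (x : F R^o) :
  exists r, forall z, ract r z = ((p z : S) * g) *: x.
Proof.
have [f fE] := fmap_full e d (orbit_map (g *: x) \o p : {linear _ -> _}).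
exists (f 1) => z; rewrite -scalerA -[RHS]fE.
congr (fmap F _ z); apply: linear_ext => t.
rewrite -[LHS](linear_orbit_map f 1); congr (f _); exact: mulr1.
Qed.

Lemma unit_in_trace : exists s : seq ({linear F R^o -> S^o} * F R^o),
  1 = \sum_(p <- s) p.1 p.2 :> S.
Proof. by have /asboolP[s sE] := trace_generates 1; exists s. Qed.

Lemma ideal_simple_transfer : ideal_simple R -> ideal_simple S.
Proof.
move=> simpleR I [I0 ID IMl IMr].
have [s sE] := unit_in_trace.
(* Quantifying over all [x] absorbs left factors (replace [x] by [ract r x]), and over all [v]
   absorbs right factors (replace [v] by [v \o ract r]). *)
pose J : set R := [set r | forall x (v : {linear F R^o -> S^o}), I (v (ract r x))].
have idealJ : is_ideal J.
  split=> [x v|r t Jr Jt x v|r t Jt x v|r t Jt x v].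
  - by rewrite ract0 linear0.
  - by rewrite ractD linearD; apply: ID; [apply: Jr|apply: Jt].
  - by rewrite ractM; apply: Jt.
  - by rewrite ractM; apply: (Jt x (v \o ract r : {linear _ -> _})).
have [J_0|J_T] := simpleR J idealJ; [left|right]; apply/seteqP; split=> //.
(* Expanding both units of [1 * g * 1] splits [g] into entries; each comes from an element of [J],
   hence vanishes. *)
- move=> g Ig /=; rewrite -[g]mul1r -[1 * g]mulr1 {1 2}sE.
  rewrite !mulr_suml big1 // => p _; rewrite mulr_sumr big1 // => q _.
  have [r rE] := matrix_entry g p.1 q.2.
  have : J r by move=> x v; rewrite rE linearZ; apply/IMr/IMl.
  rewrite J_0 => r0; have := congr1 q.1 (rE p.2).
  by rewrite r0 ract0 linear0 linearZ.
- by move=> _ ->.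
(* Now [1] is in [J], so every summand of [1] in [sE] lies in [I]. *)
- move=> g _; rewrite -[g]mulr1; apply: IMl; rewrite sE.
  elim/big_ind: _ => // p _; have : J 1 by rewrite J_T.
  by move=> /(_ p.2 p.1); rewrite ract1.
Qed.

Lemma congruence_simple_transfer : congruence_simple R -> congruence_simple S.
Proof.
move=> simpleR rho [[rho_refl rho_sym rho_trans] rhoP].
have rhoD x x' y y' : rho x x' -> rho y y' -> rho (x + y) (x' + y').
  by move=> xx' yy'; have [] := rhoP _ _ _ _ xx' yy'.
have rhoM x x' y y' : rho x x' -> rho y y' -> rho (x * y) (x' * y').
  by move=> xx' yy'; have [] := rhoP _ _ _ _ xx' yy'.
have [s sE] := unit_in_trace.
have expand g : g = \sum_(p <- s) \sum_(q <- s) p.1 p.2 * g * q.1 q.2 :> S.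
  rewrite -[LHS]mul1r -[LHS]mulr1 {1 2}sE !mulr_suml.
  by apply: eq_bigr => p _; rewrite mulr_sumr.
pose sigma r r' := forall x (v : {linear F R^o -> S^o}),
  rho (v (ract r x)) (v (ract r' x)).
have congr_sigma : is_congruence sigma.
  split; first split=> [r x v|r r' rr' x v|r r' r'' rr' rr'' x v] //.
  - exact: rho_sym.
  - exact: rho_trans (rr' x v) (rr'' x v).
  - move=> r r' t t' rr' tt'; split=> x v.
      by rewrite !ractD !linearD; apply: rhoD; [apply: rr'|apply: tt'].
    (* One factor is changed at a time. *)
    rewrite !ractM; apply: rho_trans (tt' _ v).
    exact: (rr' x (v \o ract t : {linear _ -> _})).
have [sigma_eq|sigma_all] := simpleR sigma congr_sigma; [left|right] => g g'.
(* Related [g] and [g'] give [sigma]-related, hence equal, [r] and [r'], so their entries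
   coincide. *)
- split=> [gg'|->//]; rewrite (expand g) (expand g').
  apply: eq_bigr => p _; apply: eq_bigr => q _.
  have [r rE] := matrix_entry g p.1 q.2.
  have [r' rE'] := matrix_entry g' p.1 q.2.
  have /sigma_eq rr' : sigma r r'.
    by move=> x v; rewrite rE rE' !linearZ; do 2![apply: (rhoM) => //].
  have := congr1 q.1 (rE p.2).
  by rewrite rr' rE' !linearZ => ->.
(* Here all corresponding entries of [g] and [g'] are [rho]-related, and [rho] respects sums. *)
- rewrite (expand g) (expand g').
  elim/big_ind2: _ => // [|p _]; first by move=> *; apply: rhoD.
  elim/big_ind2: _ => // [|q _]; first by move=> *; apply: rhoD.
  have [r rE] := matrix_entry g p.1 q.2.
  have [r' rE'] := matrix_entry g' p.1 q.2.
  by have := sigma_all r r' p.2 q.1; rewrite rE rE' !linearZ.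
Qed.

End Transfer.

Theorem theorem5p6 (R S : pzSemiRingType) (RS : morita_equivalent R S) :
  [/\ congruence_simple R <-> congruence_simple S,
      ideal_simple R <-> ideal_simple S &
      simple_semiring R <-> simple_semiring S].
Proof.
have [F [G [addF addG [e] [d]]]] := RS.
(* The data are symmetric: swapping [e] and [d] gives the converse transfers. *)
have RS_cong := congruence_simple_transfer e d addF.
have SR_cong := congruence_simple_transfer d e addG.
have RS_ideal := ideal_simple_transfer e d addF.
have SR_ideal := ideal_simple_transfer d e addG.
by split; split=> // -[? ?]; split; auto.
Qed.
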